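(* Let $Y_0=\{y_k\}_{k\ge0}$; for a word $w=y_{s_1}\cdots y_{s_r}$ over $Y_0$ put $(w)=s_1+\cdots+s_r$, $|w|=r$, and for $|z|<1$ $$\operatorname{Li}^-_{y_{s_1}\cdots y_{s_r}}(z)=\sum_{n_1>\cdots>n_r>0} n_1^{s_1}\cdots n_r^{s_r}z^{n_1},\qquad \operatorname{Li}^-_{1_{Y_0^*}}(z)=1,$$ and $\lambda(z)=z/(1-z)$. Then: (1) If $r>1$, then $\operatorname{Li}^-_{y_{s_1}\cdots y_{s_r}}=\sum_{t=0}^{s_1}\binom{s_1}{t}\operatorname{Li}^-_{y_t}\,\operatorname{Li}^-_{y_{s_1+s_2-t}y_{s_3}\cdots y_{s_r}}$. (2) For every $w\in Y_0^*$, $\operatorname{Li}^-_w(z)=\lambda(z)^{|w|}A^-_w(z)(1-z)^{-(w)}$, and this lies in $\mathbb{Z}[(1-z)^{-1}]$ and is a polynomial of degree $(w)+|w|$ in $(1-z)^{-1}$. Conversely, for every integer $k\ge1$, $(1-z)^{-k}=(1-z)^{-1}+\sum_{j=2}^{k}S_1(k,j)\operatorname{Li}^-_{y_{j-1}}(z)/(k-1)!$. (3) For $r\ge1$ and integers $s_1,\dots,s_r\ge1$, $$\operatorname{Li}^-_{y_{s_1}\cdots y_{s_r}}(z)=\lambda(z)^{r}\sum_{i=r}^{s_1+\cdots+s_r}\ \sum_{j=0}^{s_1+\cdots+s_{r-1}} l_{i,j}\,\frac{z^{i-1-j}}{(1-z)^{i}},$$ where $$l_{i,j}=\sum_{\substack{1\le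 k_t\le s_t\ (1\le t\le r)\\ k_1+\cdots+k_r=i}}\ \prod_{n=1}^r\big(k_n!\,S_2(s_n,k_n)\big)\sum_{\substack{0\le t_m\le k_m\ (1\le m\le r-1)\\ t_1+\cdots+t_{r-1}=j}}\ \prod_{p=1}^{r-1}\binom{k_r+\cdots+k_{r-p+1}+p-t_{r-p+1}-\cdots-t_{r-1}}{t_{r-p}}\binom{k_{r-p}+t_{r-p+1}+\cdots+t_{r-1}}{k_{r-p}-t_{r-p}}$$ (empty sums of $t$'s are $0$, and for $r=1$ the inner sum over the empty tuple, with $j=0$, equals $1$).
   Context: Eulerian polynomials: $A_0=1$ and, for $n\ge1$, $A_n(z)=\sum_{k=0}^{n-1}A_{n,k}z^k$ with $A_{n,k}=\sum_{j=0}^{k}(-1)^j\binom{n+1}{j}(k+1-j)^n$. Extended Eulerian polynomials $A^-_w$: $A^-_{1_{Y_0^*}}=1$; $A^-_{y_s}=A_s$; and for $w=y_{s_1}\cdots y_{s_r}$ with $r\ge2$, $A^-_w=\sum_{i=0}^{s_1}\binom{s_1}{i}A^-_{y_i}A^-_{y_{s_1+s_2-i}y_{s_3}\cdots y_{s_r}}$. $S_1(n,t)$ are the unsigned Stirling numbers of the first kind, $\sum_t S_1(n,t)x^t=x(x+1)\cdots(x+n-1)$; $S_2(n,k)=\frac1{k!}\sum_{i=0}^k(-1)^i\binom{k}{i}(k-i)^n$ are the Stirling numbers of the second kind. *)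

(* Defs.v *)
From HB Require Import structures.
From mathcomp Require Import all_boot all_order all_algebra.
From mathcomp Require Import complex.
From mathcomp Require Import all_classical all_reals all_analysis.
Set Implicit Arguments.
Unset Strict Implicit.
Unset Printing Implicit Defensive.
Import Order.TTheory GRing.Theory Num.Theory.
Import numFieldNormedType.Exports.
Local Open Scope ring_scope.

(* Packaging R[i] as a numClosedFieldType gives it the topology of the complex
   modulus, which the library derives for an arbitrary numClosedFieldType. *)
Definition Cplx (R : realType) : numClosedFieldType := R[i].

(* A word y_{s_1} ... y_{s_r} over Y_0 is the sequence [:: s_1; ...; s_r] of
   type seq nat; thus |w| = size w and (w) = sumn w. *)

(* a_m for a finite sequence a = [:: a_1; ...; a_n] indexed from 1. *)
Definition entry (a : seq nat) (m : nat) : nat := nth 0%N a m.-1.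

(* The sum of n_1^{s_1} ... n_r^{s_r} z^{n_1} over N > n_1 > ... > n_r > 0. *)
Definition Li_partial (R : realType) (s : seq nat) (z : Cplx R) (N : nat) : Cplx R :=
  \sum_(n : (size s).-tuple 'I_N |
         sorted gtn (map val n) && all (leq 1) (map val n))
    (\prod_(1 <= m < (size s).+1)
       (entry (map val n) m)%:R ^+ entry s m)
    * z ^+ entry (map val n) 1.

(* lim is total, with a junk value on divergent sequences. *)
Definition Li (R : realType) (s : seq nat) (z : Cplx R) : Cplx R :=
  if s is [::] then 1 else limn (Li_partial s z).

Definition lambda (R : realType) (z : Cplx R) : Cplx R := z / (1 - z).

Definition eulerian_coef (n k : nat) : int :=
  \sum_(0 <= j < k.+1)
    (-1) ^+ j * ('C(n.+1, j))%:R * ((k.+1 - j)%N%:R) ^+ n.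

Definition eulerian (n : nat) : {poly int} :=
  if n is 0 then 1 else \poly_(k < n) eulerian_coef n k.

(* ext_eulerian_cons s w is the polynomial of the nonempty word y_s w.  The
   recursion replaces y_{s_1} y_{s_2} w' by the words y_{s_1+s_2-i} w', which
   are not subterms; separating the first letter makes it structural. *)
Fixpoint ext_eulerian_cons (s : nat) (w : seq nat) : {poly int} :=
  if w is s2 :: w' then
    \sum_(i < s.+1)
      ('C(s, i))%:R * eulerian i * ext_eulerian_cons (s + s2 - i) w'
  else eulerian s.

Definition ext_eulerian (w : seq nat) : {poly int} :=
  if w is s :: w' then ext_eulerian_cons s w' else 1.

Definition stirling1 (n t : nat) : int :=
  (\prod_(i < n) ('X + (i%:R)%:P) : {poly int})`_t.

Definition stirling2 (n k : nat) : rat :=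
  (k`!)%:R^-1 *
  \sum_(0 <= i < k.+1) (-1) ^+ i * ('C(k, i))%:R * ((k - i)%N%:R) ^+ n.

(* k = (k_1, ..., k_r), t = (t_1, ..., t_{r-1}); the only subtractions are
   k_r + ... + k_{r-p+1} + p - (t_{r-p+1} + ... + t_{r-1}) and
   k_{r-p} - t_{r-p}, both nonnegative when t_m <= k_m for all m, so the
   truncated subtraction of nat is exact where it is used below. *)
Definition lcoef_binom (r : nat) (k t : seq nat) : nat :=
  \prod_(1 <= p < r)
    ('C(\sum_(r - p + 1 <= m < r.+1) entry k m + p
          - \sum_(r - p + 1 <= m < r) entry t m,
        entry t (r - p))
     * 'C(entry k (r - p) + \sum_(r - p + 1 <= m < r) entry t m,
          entry k (r - p) - entry t (r - p)))%N.

(* The bound (sumn s).+1 on the ordinals only makes the index types finite: it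
   is implied by k_m <= s_m and t_m <= k_m. *)
Definition lcoef (s : seq nat) (i j : nat) : rat :=
  let r := size s in
  \sum_(k : r.-tuple 'I_(sumn s).+1 |
         [forall m : 'I_r, (1 <= tnth k m <= entry s m.+1)%N]
         && (sumn (map val k) == i))
    (\prod_(1 <= n < r.+1)
       (((entry (map val k) n)`!)%:R
          * stirling2 (entry s n) (entry (map val k) n)))
    * \sum_(t : (r.-1).-tuple 'I_(sumn s).+1 |
             [forall m : 'I_r.-1, (tnth t m <= entry (map val k) m.+1)%N]
             && (sumn (map val t) == j))
        (lcoef_binom r (map val k) (map val t))%:R.

(* Main.v *)
From HB Require Import structures.
From mathcomp Require Import all_boot all_order all_algebra.
From mathcomp Require Import complex ring zify.
From mathcomp Require Import all_classical all_reals all_analysis.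
Require Import Defs.
Set Implicit Arguments.
Unset Strict Implicit.
Unset Printing Implicit Defensive.
Import Order.TTheory GRing.Theory Num.Theory.
Import numFieldNormedType.Exports.
Local Open Scope ring_scope.

(* In the variable x = lambda(z) = z/(1-z) one has 1/(1-z) = 1 + x and
   z d/dz = x(1+x) d/dx, while summing over m < n multiplies a generating
   function by x.  Hence Li_w(z) is P_w(x), where P_w is an integer polynomial
   obtained from x by applying D = x(1+x) d/dx and multiplication by x.  Then
   (1) is the Leibniz rule for D^s1; (2) expresses D^s x through Eulerian
   numbers, D raising the degree by one, and inverts
   D(1+x)^k = k((1+x)^(k+1) - (1+x)^k); (3) expands D^s in the operators
   D(D-1)...(D-k+1)/k!, which act on x^a (1+x)^(c+1) by an explicit sum. *)

(** * Power series coefficients of the powers of lambda *)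

(* The coefficient of z^n in lambda(z)^k. *)
Fixpoint lambda_coef (k n : nat) : nat :=
  match k, n with
  | 0, 0 => 1
  | k'.+1, n'.+1 => lambda_coef k n' + lambda_coef k' n'
  | _, _ => 0
  end.

Lemma lambda_coef_small (k n : nat) : (n < k)%N -> lambda_coef k n = 0%N.
Proof. by elim: n k => [|n IHn] [|k] //= ltnk; rewrite !IHn // ltnW. Qed.

Lemma lambda_coef1 n : lambda_coef 1 n = (0 < n)%N.
Proof. by case: n => //; elim=> //= n ->. Qed.

(** Since lambda(z) = z + z^2 + ..., multiplication by it sums the coefficients of strictly smaller
    index. *)
Lemma lambda_coef_sum (k n : nat) :
  (\sum_(m < n) lambda_coef k m)%N = lambda_coef k.+1 n.
Proof.
elim: n => [|n IHn]; first by rewrite big_ord0.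
by rewrite big_ord_recr /= IHn.
Qed.

(** Coefficient form of z d/dz lambda^k = k (lambda^k + lambda^(k+1)); the inductive step adds the
    hypotheses at k and k + 1. *)
Lemma lambda_coef_euler (k n : nat) :
  (n * lambda_coef k n = k * (lambda_coef k n + lambda_coef k.+1 n))%N.
Proof.
elim: n k => [|n IHn] [|k]; rewrite /= ?mul0n ?addn0 ?muln0 //.
by have := IHn k; have := IHn k.+1; nia.
Qed.

(** The recursion is dominated by Pascal's, so the left side is at most one term of the binomial
    expansion. As h > 0 can be taken arbitrarily small, the coefficients grow subexponentially in
    n. *)
Lemma lambda_coef_le (K : numDomainType) (h : K) (k n : nat) : 0 <= h ->
  (lambda_coef k n)%:R * h ^+ k <= (1 + h) ^+ n.
Proof.
move=> h0; have h1 : 0 <= 1 + h by rewrite addr_ge0.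
elim: n k => [|n IHn] [|k]; rewrite ?mulr1 ?mul0r ?exprn_ge0 //=.
rewrite natrD mulrDl [leRHS]exprSr mulrDr mulr1 lerD ?IHn //.
by rewrite exprSr mulrA ler_wpM2r ?IHn.
Qed.

(** * Polynomials in lambda and the operator z d/dz *)

Section EulerOperator.
Variable K : comNzRingType.
Implicit Types (p q : {poly K}) (w : seq nat).

(* The coefficient of z^n in p(lambda(z)). *)
Definition zcoef (n : nat) p : K :=
  \sum_(k < n.+1) p`_k * (lambda_coef k n)%:R.

Lemma zcoef_widen (n N : nat) p : (n <= N)%N ->
  \sum_(k < N.+1) p`_k * (lambda_coef k n)%:R = zcoef n p.
Proof.
move=> nN; rewrite -(subnKC nN) -addSn big_split_ord /= [X in _ + X]big1 ?addr0//.
by move=> i _; rewrite /= lambda_coef_small ?mulr0 // addSn ltnS leq_addr.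
Qed.

Lemma zcoef_size (n : nat) p :
  zcoef n p = \sum_(k < size p) p`_k * (lambda_coef k n)%:R.
Proof.
rewrite -(zcoef_widen _ (leq_addr (size p) n)) -addnS addnC addSn -addnS.
rewrite big_split_ord /= [X in _ + X]big1 ?addr0 // => i _.
by rewrite nth_default ?mul0r //= leq_addr.
Qed.

Lemma zcoefX n : zcoef n 'X = (0 < n)%N%:R.
Proof.
rewrite zcoef_size size_polyX big_ord_recl big_ord1 !coefX mul0r add0r mul1r.
by rewrite lambda_coef1.
Qed.

Lemma zcoef_mulX (n : nat) p : zcoef n ('X * p) = \sum_(m < n) zcoef m p.
Proof.
rewrite /zcoef big_ord_recl coefXM mul0r add0r.
transitivity (\sum_(m < n) \sum_(k < n) p`_k * (lambda_coef k m)%:R).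
  rewrite exchange_big; apply: eq_bigr => k _.
  by rewrite coefXM -mulr_sumr -natr_sum lambda_coef_sum.
case: n => [|n]; first by rewrite !big_ord0.
by apply: eq_bigr => m _; rewrite zcoef_widen // -ltnS.
Qed.

(* z d/dz in the variable lambda(z). *)
Definition euler_op p : {poly K} := 'X * (1 + 'X) * p^`().

Lemma coef_euler_op p k : (euler_op p)`_k = p`_k *+ k + (p`_k.-1) *+ k.-1.
Proof.
rewrite /euler_op -mulrA coefXM; case: k => [|k] /=; first by rewrite addr0.
rewrite mulrDl mul1r coefD coefXM !coef_deriv.
by case: k => [|k].
Qed.

(** By the chain rule and z lambda' = lambda (1 + lambda), [euler_op] is z d/dz, which multiplies
    the coefficient of z^n by n. *)
Lemma zcoef_euler (n : nat) p : zcoef n (euler_op p) = n%:R * zcoef n p.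
Proof.
rewrite -(zcoef_widen _ (leqnSn n)) -[in RHS](zcoef_widen _ (leqnSn n)).
under eq_bigr do rewrite coef_euler_op mulrDl.
rewrite big_split /= [X in _ + X]big_ord_recl mulr0n mul0r add0r.
rewrite mulr_sumr [X in X + _]big_ord_recr /= [in RHS]big_ord_recr /=.
rewrite lambda_coef_small// !mulr0 !addr0 -big_split /=; apply: eq_bigr => k _.
rewrite -[p`_k *+ k]mulr_natr mulrCA -natrM lambda_coef_euler natrM natrD.
by rewrite -!mulrA mulrDr mulrDr.
Qed.

Lemma zcoef_iter_euler (n s : nat) p :
  zcoef n (iter s euler_op p) = n%:R ^+ s * zcoef n p.
Proof.
by elim: s => [|s IHs]; rewrite ?mul1r //= zcoef_euler IHs mulrA exprS.
Qed.

(* tail_poly w represents the generating function, over n > 0, of the sums of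
   n_1^{s_1} ... n_r^{s_r} over n > n_1 > ... > n_r > 0; Li_poly s w is the
   polynomial of the nonempty word y_s w. *)
Fixpoint tail_poly (w : seq nat) : {poly K} :=
  if w is s :: w' then 'X * iter s euler_op (tail_poly w') else 'X.

Definition Li_poly s w := iter s euler_op (tail_poly w).

Lemma euler_opD p q : euler_op (p + q) = euler_op p + euler_op q.
Proof. by rewrite /euler_op derivD mulrDr. Qed.

Lemma euler_opZ c p : euler_op (c *: p) = c *: euler_op p.
Proof. by rewrite /euler_op derivZ scalerAr. Qed.

Lemma euler_opM p q : euler_op (p * q) = euler_op p * q + p * euler_op q.
Proof. by rewrite /euler_op derivM; ring. Qed.

Lemma euler_opMn p n : euler_op (p *+ n) = euler_op p *+ n.
Proof. by rewrite /euler_op derivMn mulrnAr. Qed.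

Lemma euler_op_sum (I : Type) (r : seq I) (P : pred I) (F : I -> {poly K}) :
  euler_op (\sum_(i <- r | P i) F i) = \sum_(i <- r | P i) euler_op (F i).
Proof. by apply: (big_morph _ euler_opD); rewrite /euler_op deriv0 mulr0. Qed.

Lemma iter_euler_opZ n c p : iter n euler_op (c *: p) = c *: iter n euler_op p.
Proof. by elim: n => //= n ->; rewrite euler_opZ. Qed.

Lemma iter_euler_op_sum n (I : Type) (r : seq I) (P : pred I) (F : I -> {poly K}) :
  iter n euler_op (\sum_(i <- r | P i) F i) =
  \sum_(i <- r | P i) iter n euler_op (F i).
Proof. by elim: n => //= n ->; rewrite euler_op_sum. Qed.

(** [euler_op] is a derivation, so the induction of the binomial theorem applies, with Pascal's rule
    merging the two sums. *)
Lemma iter_euler_opM n p q :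
  iter n euler_op (p * q) =
  \sum_(i < n.+1) 'C(n, i)%:R * iter i euler_op p * iter (n - i) euler_op q.
Proof.
elim: n => [|n IHn]; first by rewrite big_ord1 !mul1r.
rewrite iterS IHn euler_op_sum.
under eq_bigr do
  rewrite -mulrA mulr_natl euler_opMn euler_opM mulrnDl -!(mulr_natl (_ * _)).
rewrite big_split /= addrC [RHS]big_ord_recl /= bin0 ?subn0.
under [X in _ = _ + X]eq_bigr do
  rewrite /bump /= add1n binS natrD subSS -mulrA mulrDl.
rewrite big_split /= addrA; congr (_ + _).
rewrite [in RHS]big_ord_recr /= bin_small// mul0r addr0.
rewrite big_ord_recl /= bin0 ?subn0 !mul1r; congr (_ + _).
by apply: eq_bigr => i _; rewrite /bump /= add1n -[(n - i)%N]subnSK.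
Qed.
End EulerOperator.
Arguments euler_op {K} p.

(** * Degrees in characteristic zero *)

Section Size.
Variable K : numDomainType.
Implicit Types (p : {poly K}) (s : nat) (w : seq nat).

Lemma size_deriv_num p : size p^`() = (size p).-1.
Proof.
have [p0|] := leqP (size p) 1.
  by rewrite (size1_polyC p0) derivC size_poly0 size_polyC; case: (_ != 0).
case E: (size p) => [|[|n]] // _; apply/eqP; rewrite eqn_leq; apply/andP; split.
  by rewrite -ltnS -E lt_size_deriv // -size_poly_gt0 E.
rewrite ltnNge; apply/negP => /(nth_default 0).
rewrite coef_deriv => /eqP; rewrite mulrn_eq0 /= -[n.+1]/(n.+2.-1) -E.
by rewrite -lead_coefE lead_coef_eq0 -size_poly_eq0 E.
Qed.

Lemma size_euler_op p : (1 < size p)%N -> size (euler_op p) = (size p).+1.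
Proof.
move=> p1; rewrite /euler_op mulrDr mulr1 -expr2.
have p'0 : p^`() != 0.
  by rewrite -size_poly_gt0 size_deriv_num; case: size p1 => [|[]].
have s3 : size ('X + 'X^2 : {poly K}) = 3.
  by rewrite addrC size_polyDl size_polyXn // size_polyX.
rewrite size_mul // -?size_poly_gt0 s3 // size_deriv_num.
by case: size p1 => [|[]].
Qed.

Lemma size_iter_euler_op s p : (1 < size p)%N ->
  size (iter s euler_op p) = (s + size p)%N.
Proof.
move=> p1; elim: s => [|s IHs] //; rewrite iterS size_euler_op IHs //.
by rewrite (leq_trans p1) ?leq_addl.
Qed.

(** A letter y_s raises the degree by s through [euler_op] and by 1 through the factor X; the
    initial X has size 2. *)
Lemma size_tail_poly w : size (tail_poly K w) = (sumn w + size w).+2.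
Proof.
elim: w => [|s w IHw] /=; first by rewrite size_polyX.
rewrite mulrC size_mulX -?size_poly_gt0 size_iter_euler_op IHw //; lia.
Qed.

Lemma size_Li_poly s w :
  size (Li_poly K s w) = (sumn (s :: w) + size (s :: w)).+1.
Proof. rewrite size_iter_euler_op size_tail_poly //=; lia. Qed.
End Size.

(** * Change of coefficient ring between integers, rationals and complex numbers *)

Section Map.
Variables (K L : comNzRingType) (f : {rmorphism K -> L}).

Lemma map_euler_op p : map_poly f (euler_op p) = euler_op (map_poly f p).
Proof.
by rewrite /euler_op !rmorphM rmorphD rmorph1 /= map_polyX deriv_map.
Qed.

Lemma map_iter_euler_op s p :
  map_poly f (iter s euler_op p) = iter s euler_op (map_poly f p).
Proof. by elim: s => //= s <-; rewrite map_euler_op. Qed.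

Lemma map_tail_poly w : map_poly f (tail_poly K w) = tail_poly L w.
Proof.
elim: w => [|s w IHw] /=; first exact: map_polyX.
by rewrite rmorphM /= map_polyX map_iter_euler_op IHw.
Qed.

Lemma map_Li_poly s w : map_poly f (Li_poly K s w) = Li_poly L s w.
Proof. by rewrite map_iter_euler_op map_tail_poly. Qed.
End Map.

(** * The recursion on the first two letters *)

(** Leibniz rule for D^s1 on the product of X and D^s2 of the tail: the first factor gives D^t X,
    and the exponents s1 - t and s2 add up on the second. *)
Lemma Li_poly_shuffle (K : comNzRingType) s1 s2 w :
  Li_poly K s1 (s2 :: w) =
  \sum_(t < s1.+1)
    'C(s1, t)%:R * Li_poly K t [::] * Li_poly K (s1 + s2 - t) w.
Proof.
rewrite /Li_poly /= iter_euler_opM; apply: eq_bigr => t _.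
by rewrite -iterD addnBAC // -ltnS.
Qed.

(** * Eulerian numbers *)

Lemma eulerian_coef0 n : eulerian_coef n 0 = 1.
Proof. by rewrite /eulerian_coef big_nat1 bin0 expr1n !mulr1. Qed.

(** The alternating sums agree term by term, by Pascal's rule and the absorption identity (j+1)
    C(n+2,j+1) = (n+2) C(n+1,j). *)
Lemma eulerian_coefS n k :
  eulerian_coef n.+1 k.+1 =
  k.+2%:R * eulerian_coef n k.+1 + (n%:R - k%:R) * eulerian_coef n k.
Proof.
rewrite /eulerian_coef !mulr_sumr big_nat_recl // [X in _ = X + _]big_nat_recl //.
rewrite !bin0 !subn0 !expr0 !mul1r exprS -addrA; congr (_ + _).
rewrite -big_split /=; apply: eq_big_nat => j /andP[_ jk].
have E : j.+1%:R * 'C(n.+2, j.+1)%:R = n.+2%:R * 'C(n.+1, j)%:R :> int.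
  by rewrite -!natrM mul_bin_diag.
rewrite (binS n.+1 j) (natrD _ 'C(n.+1, j.+1)) in E *.
move: ('C(n.+1, j.+1)%:R) E => c1; move: ('C(n.+1, j)%:R) => c0 E.
rewrite subSS subSn // !exprS -[(k - j).+1]addn1 natrD natrB //.
set x := _ ^+ n; set e := _ ^+ j.
(* The extra factor k + 1 - j is split as (k+2) - (j+1), so that [E] applies to the second
   product. *)
transitivity (- (e * x) * (k.+2%:R * (c1 + c0) - j.+1%:R * (c1 + c0))).
  by ring.
by rewrite E; ring.
Qed.

(** The recurrence propagates the vanishing, its factor n - k being zero on the boundary k = n. The
    index 0 is excluded because A_{0,0} = 1. *)
Lemma eulerian_coef_ge n k : (0 < k)%N -> (n <= k)%N -> eulerian_coef n k = 0.
Proof.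
elim: n k => [|n IHn] [|k] // _ nk.
  rewrite /eulerian_coef !big_nat_recl //= big1_seq ?bin0 ?bin1 /=.
    by rewrite !expr0 !mulr1 addr0 subrr.
  by move=> i _; rewrite bin_small // mulr0 mul0r.
rewrite eulerian_coefS IHn // ?(leq_trans nk) // 1?ltnW // mulr0 add0r /=.
have [->|nk1] := eqVneq n k; first by rewrite subrr mul0r.
by rewrite IHn ?mulr0 //; lia.
Qed.

Lemma coef_eulerian n k : (eulerian n)`_k = eulerian_coef n k.
Proof.
case: n => [|n] /=.
  by rewrite coef1; case: k => [|k]; rewrite ?eulerian_coef0 ?eulerian_coef_ge.
rewrite coef_poly; case: ltnP => // nk; rewrite eulerian_coef_ge //.
exact: leq_ltn_trans nk.
Qed.

(** * Eulerian expansion and inversion by Stirling numbers of the first kind *)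

Section Inversion.
Variable K : comNzRingType.

(** Product rule applied to D X^a = a X^a (1+X) and D (1+X)^b = b X (1+X)^b. *)
Lemma euler_op_monomial a b :
  euler_op ('X^a * (1 + 'X) ^+ b : {poly K}) =
  a%:R *: ('X^a * (1 + 'X) ^+ b.+1) + b%:R *: ('X^(a.+1) * (1 + 'X) ^+ b).
Proof.
have DX n : euler_op ('X^n : {poly K}) = n%:R *: 'X^n * (1 + 'X).
  elim: n => [|n IHn]; first by rewrite scale0r mul0r /euler_op derivC mulr0.
  rewrite exprS euler_opM IHn /euler_op derivX -!mul_polyC !polyC_natr -natr1; ring.
have D1X n : euler_op ((1 + 'X) ^+ n : {poly K}) = n%:R *: 'X * (1 + 'X) ^+ n.
  elim: n => [|n IHn]; first by rewrite scale0r mul0r /euler_op derivC mulr0.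
  rewrite exprS euler_opM IHn /euler_op derivD derivC derivX add0r.
  rewrite -!mul_polyC !polyC_natr -natr1; ring.
by rewrite euler_opM DX D1X -!mul_polyC !exprS; ring.
Qed.

(** D kills constants, so X and 1 + X, that is lambda(z) and (1-z)^-1, have the same iterates from
    the first on. *)
Lemma iter_euler_op_addl1 n :
  iter n.+1 euler_op (1 + 'X : {poly K}) = Li_poly K n.+1 [::].
Proof. by rewrite /Li_poly !iterSr /euler_op derivD derivC add0r. Qed.

(** D multiplies X^(k+1) (1+X)^(s-k) by (k+1)(1+X) + (s-k)X; collecting terms gives exactly the
    recurrence [eulerian_coefS]. *)
Lemma Li_poly1 s :
  Li_poly K s [::] =
  \sum_(k < s.+1) (eulerian_coef s k)%:~R *: ('X^(k.+1) * (1 + 'X) ^+ (s - k)).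
Proof.
elim: s => [|s IHs].
  by rewrite big_ord1 eulerian_coef0 scale1r mulr1.
rewrite /Li_poly iterS [iter _ _ _]IHs euler_op_sum.
under eq_bigr do rewrite euler_opZ euler_op_monomial scalerDr.
rewrite big_split /= big_ord_recl [RHS]big_ord_recl !eulerian_coef0 !scale1r subn0.
rewrite -addrA; congr (_ + _).
under [RHS]eq_bigr do rewrite lift0 eulerian_coefS rmorphD scalerDl.
rewrite [RHS]big_split /=; congr (_ + _).
  rewrite [RHS]big_ord_recr /= eulerian_coef_ge // mulr0 scale0r addr0.
  apply: eq_bigr => k _; rewrite /bump /= add1n subSS scalerA rmorphM /=.
  by rewrite rmorph_nat mulrC subnSK.
apply: eq_bigr => k _; rewrite subSS scalerA mulrC rmorphM rmorphB /= !rmorph_nat.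
by rewrite natrB // -ltnS.
Qed.

Lemma stirling1S k j :
  stirling1 k.+1 j.+1 = stirling1 k j + k%:R * stirling1 k j.+1.
Proof.
rewrite /stirling1 big_ord_recr /= mulrDr coefD coefMX /= coefMC.
by rewrite mulrC.
Qed.

Lemma stirling1_gt k j : (k < j)%N -> stirling1 k j = 0.
Proof.
elim: k j => [|k IHk] [|j] // kj; first by rewrite /stirling1 big_ord0 coef1.
by rewrite stirling1S !IHk ?mulr0 // ltnW.
Qed.

Lemma stirling1_0 k : stirling1 k.+1 0 = 0.
Proof. by rewrite /stirling1 big_ord_recl /= addr0 mulrC coefMX. Qed.

Lemma stirling1_1 k : stirling1 k.+1 1 = k`!%:R.
Proof.
elim: k => [|k IHk]; last first.
  by rewrite stirling1S stirling1_0 IHk add0r -natrM factS.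
by rewrite stirling1S /stirling1 big_ord0 !coef1 mulr0.
Qed.

(** Since (D + k + 1) (1+X)^(k+1) = (k+1) (1+X)^(k+2), the left side is (D+1)...(D+k) applied to 1 +
    X, and the coefficients of this product are the S_1(k+1,j+1). *)
Lemma stirling1_inversion k :
  k`!%:R *: (1 + 'X) ^+ k.+1 =
  \sum_(j < k.+1)
    (stirling1 k.+1 j.+1)%:~R *: iter j euler_op (1 + 'X : {poly K}).
Proof.
elim: k => [|k IHk]; first by rewrite big_ord1 stirling1_1.
transitivity (euler_op (k`!%:R *: (1 + 'X) ^+ k.+1)
              + k.+1%:R *: (k`!%:R *: (1 + 'X) ^+ k.+1) : {poly K}).
  have := euler_op_monomial 0 k.+1; rewrite mul1r scale0r add0r euler_opZ => ->.
  rewrite factS natrM -!mul_polyC !polyCM !polyC_natr [_ ^+ k.+2]exprS; ring.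
rewrite IHk euler_op_sum.
under [RHS]eq_bigr do rewrite stirling1S rmorphD scalerDl.
rewrite big_split /= [in RHS]big_ord_recl /= stirling1_0 scale0r add0r.
rewrite [X in _ = _ + X]big_ord_recr /= stirling1_gt // mulr0 scale0r addr0.
congr (_ + _); first by apply: eq_bigr => j _; rewrite euler_opZ.
rewrite scaler_sumr; apply: eq_bigr => j _.
by rewrite scalerA rmorphM /= rmorph_nat.
Qed.
End Inversion.

(** * Sums over tuples and over strictly decreasing indices *)

Lemma big_tuple0 (V : nmodType) (T : finType) (P : pred (0.-tuple T))
    (F : 0.-tuple T -> V) :
  \sum_(t | P t) F t = if P [tuple] then F [tuple] else 0.
Proof.
rewrite big_mkcond (bigD1 [tuple]) //= big1 ?addr0 // => t.
by rewrite tuple0.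
Qed.

Lemma big_tupleS (V : nmodType) (T : finType) (r : nat) (P : pred (seq T))
    (F : seq T -> V) :
  \sum_(t : r.+1.-tuple T | P t) F t =
  \sum_(i : T) \sum_(t : r.-tuple T | P (i :: t)) F (i :: t).
Proof.
under [RHS]eq_bigr do rewrite big_mkcond.
rewrite pair_big /= big_mkcond.
rewrite (reindex (fun p : T * r.-tuple T => [tuple of p.1 :: p.2])) //=.
exists (fun t => (thead t, [tuple of behead t])) => [[x t] _|t _] /=.
  by congr (_, _); apply: val_inj.
by rewrite [RHS]tuple_eta; apply: val_inj.
Qed.

Section Strict.
Variable K : comNzRingType.

Definition weight (w n : seq nat) : K :=
  \prod_(1 <= m < (size w).+1) (entry n m)%:R ^+ entry w m.

Lemma weight_cons s w i n : weight (s :: w) (i :: n) = i%:R ^+ s * weight w n.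
Proof.
by rewrite /weight big_nat_recl //; congr (_ * _); apply: eq_big_nat => -[].
Qed.

(** Fixing the largest entry j < i leaves the same sum for the shorter word, bounded by j. Summing
    over j is the factor X of [tail_poly], and j^s comes from [iter s euler_op]. *)
Lemma sum_weight_decreasing w N (i : nat) : (0 < i)%N -> (i <= N)%N ->
  \sum_(n : (size w).-tuple 'I_N |
      path gtn i (map val n) && all (leq 1) (map val n)) weight w (map val n)
  = zcoef i (tail_poly K w).
Proof.
elim: w i => [|s w IHw] i i0 iN /=.
  by rewrite big_tuple0 /= /weight big_geq // zcoefX i0.
rewrite zcoef_mulX (@big_tupleS _ _ _
  (fun n => path gtn i (map val n) && all (leq 1) (map val n))
  (fun n => weight (s :: w) (map val n))) /=.
rewrite (big_ord_widen N (fun m => zcoef m (iter s euler_op (tail_poly K w)))) //.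
rewrite [RHS]big_mkcond; apply: eq_bigr => j _ /=.
under eq_bigr do rewrite weight_cons.
rewrite -mulr_sumr zcoef_iter_euler; case: (ltnP j i) => ji; last first.
  by rewrite big_pred0 ?mulr0 // => n; rewrite /= ltnNge ji.
(* The left side excludes j = 0. On the right j^s is 1 there when s = 0, so it is the zero constant
   term of [tail_poly] that makes the product vanish. *)
have [j0|j0] := posnP j.
  rewrite j0 big_pred0 ?mulr0 => [|n]; last by rewrite /= andbF.
  rewrite /zcoef big_ord1.
  by case: w {IHw} => [|t w]; rewrite /= ?coefX ?coefXM !mul0r mulr0.
by rewrite -(IHw j) // 1?ltnW //; congr (_ * _); apply: eq_bigl => n.
Qed.
End Strict.

(** * Stirling numbers of the second kind and the powers of z d/dz *)

(* The number of surjections from a set of size n to a set of size k. *)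
Definition surj (n k : nat) : rat := k`!%:R * stirling2 n k.

Lemma surjE n k : surj n k =
  \sum_(i < k.+1) (-1) ^+ i * ('C(k, i))%:R * ((k - i)%N%:R) ^+ n.
Proof.
by rewrite /surj /stirling2 mulVKf ?big_mkord // pnatr_eq0 -lt0n fact_gt0.
Qed.

Lemma surj0n k : surj 0 k = (k == 0)%:R.
Proof.
(* The sum is the binomial expansion of (1 - 1)^k. *)
rewrite surjE; have := exprDn (1 : rat) (-1) k; rewrite addrN expr0n => ->.
by apply: eq_bigr => i _; rewrite expr1n mul1r mulr1 mulr_natr.
Qed.

Lemma surjn0 n : surj n.+1 0 = 0.
Proof. by rewrite surjE big_ord1 subnn expr0n mulr0. Qed.

(** The identity (k+1-i) C(k+1,i) = (k+1) C(k,i) extracts one factor of the power; Pascal's rule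
    then separates the two sums. *)
Lemma surjSS n k : surj n.+1 k.+1 = k.+1%:R * (surj n k.+1 + surj n k).
Proof.
rewrite !surjE.
transitivity (k.+1%:R *
  \sum_(i < k.+2) (-1) ^+ i * 'C(k, i)%:R * (k.+1 - i)%N%:R ^+ n : rat).
  rewrite mulr_sumr; apply: eq_bigr => i _; rewrite exprS.
  have /(congr1 (fun m => m%:R : rat)) := mul_bin_down k.+1 i.
  rewrite !natrM /=; move: ('C(_, _)%:R) ('C(_, _)%:R) (_ - _)%:R => c c' d E.
  set x := _ ^+ n; set e := _ ^+ i.
  by transitivity (e * x * (d * c)); [ring|rewrite -E; ring].
congr (_ * _); rewrite big_ord_recl [X in _ = X + _]big_ord_recl -addrA !bin0.
congr (_ + _); rewrite -big_split /=; apply: eq_bigr => i _.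
by rewrite /bump /= add1n subSS binS natrD exprS; ring.
Qed.

Lemma surj_gt n k : (n < k)%N -> surj n k = 0.
Proof.
elim: n k => [|n IHn] [|k] //; first by rewrite surj0n.
by move=> nk; rewrite surjSS !IHn ?addr0 ?mulr0 // ltnW.
Qed.

(* (z^k/k!) d^k/dz^k of z^a (1-z)^-(a+c+1), in the variable lambda(z). *)
Definition divided_euler (k a c : nat) : {poly rat} :=
  \sum_(t < k.+1)
    ('C(a, t) * 'C(c + k, k - t))%:R *:
      ('X^(a + k - t) * (1 + 'X) ^+ (c + t).+1).

(** This is z d/dz (z^k d^k) = k z^k d^k + z^(k+1) d^(k+1), divided by k!, checked on the explicit
    sums. *)
Lemma euler_op_divided k a c :
  euler_op (divided_euler k a c) =
  k%:R *: divided_euler k a c + k.+1%:R *: divided_euler k.+1 a c.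
Proof.
(* [T] and [T'] are the monomials at levels k and k + 1. As (1+X) - X = 1, [T t] is a difference of
   consecutive [T'], so everything can be compared in the [T']. *)
pose T (t : nat) : {poly rat} := 'X^(a + k - t) * (1 + 'X) ^+ (c + t).+1.
pose T' (t : nat) : {poly rat} := 'X^(a + k.+1 - t) * (1 + 'X) ^+ (c + t).+1.
have TT' t : (t <= a + k)%N -> T t = T' t.+1 - T' t.
  move=> tak; rewrite /T /T' addnS subSS addnS [_ ^+ (c + t).+2]exprS.
  by rewrite subSn // !exprS; ring.
have DT t : (t <= a)%N ->
    euler_op (T t) - k%:R *: T t =
    (a%:R - t%:R) *: T' t.+1 + (k + c + t).+1%:R *: T' t.
  move=> ta; have tak : (t <= a + k)%N by rewrite (leq_trans ta) ?leq_addr.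
  rewrite euler_op_monomial -/(T t).
  have -> : 'X^(a + k - t) * (1 + 'X) ^+ (c + t).+2 = T' t.+1.
    by rewrite /T' addnS subSS addnS.
  have -> : 'X^((a + k - t).+1) * (1 + 'X) ^+ (c + t).+1 = T' t.
    by rewrite /T' addnS subSn.
  rewrite TT' // natrB // natrD -!mul_polyC.
  rewrite !(polyCB, polyCD, polyC_natr, natrD, =^~ natr1); ring.
apply/eqP; rewrite addrC -subr_eq; apply/eqP.
rewrite /divided_euler euler_op_sum [k%:R *: _]scaler_sumr -sumrB.
have -> : \sum_(t < k.+1) (euler_op (('C(a, t) * 'C(c + k, k - t))%:R *: T t) -
      k%:R *: (('C(a, t) * 'C(c + k, k - t))%:R *: T t)) =
   \sum_(t < k.+1) ((t.+1 * 'C(a, t.+1) * 'C(c + k, k - t))%:R *: T' t.+1) +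
   \sum_(t < k.+1) (((k + c + t).+1 * 'C(a, t) * 'C(c + k, k - t))%:R *: T' t).
  rewrite -big_split; apply: eq_bigr => t _ /=.
  rewrite euler_opZ scalerA mulrC -scalerA -scalerBr.
  have [ta|ta] := leqP t a; last first.
    by rewrite (bin_small ta) (bin_small (leqW ta)) !muln0 !mul0n !scale0r addr0.
  rewrite DT // scalerDr !scalerA; congr (_ *: _ + _ *: _).
    by rewrite mul_bin_left -natrB // -natrM mulnC mulnA.
  by rewrite -natrM mulnC mulnA.
have -> : \sum_(t < k.+1) (t.+1 * 'C(a, t.+1) * 'C(c + k, k - t))%:R *: T' t.+1 =
   \sum_(t < k.+2) (t * 'C(a, t) * 'C(c + k, k.+1 - t))%:R *: T' t.
  by rewrite [RHS]big_ord_recl !mul0n scale0r add0r.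
rewrite big_ord_recr /= addrAC -big_split /= scaler_sumr [RHS]big_ord_recr /=.
congr (_ + _); last by rewrite scalerA subnn !bin0 !muln1 natrM.
apply: eq_bigr => t _; rewrite -scalerDl scalerA -natrD -natrM.
congr (_%:R *: _); have tk : (t <= k)%N by rewrite -ltnS.
(* Apart from the common factor C(a,t), Pascal's rule reduces the claim to (k+1-t) C(c+k,k+1-t) =
   (c+t) C(c+k,k-t). *)
have := mul_bin_left (c + k) (k - t); rewrite subSn // addnS binS.
move: ('C(_, _)) ('C(_, _)) ('C(_, _)) => A B C.
have -> : (c + k - (k - t) = c + t)%N by lia.
have := subnK tk; move: (k - t)%N (nat_of_ord t) => m n <- E; nia.
Qed.

(** The classical expansion of (z d/dz)^s as the sum of S_2(s,k) z^k d^k/dz^k; [euler_op_divided]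
    matches the recurrence [surjSS]. *)
Lemma iter_euler_op_monomial s a c :
  iter s euler_op ('X^a * (1 + 'X) ^+ c.+1 : {poly rat}) =
  \sum_(k < s.+1) surj s k *: divided_euler k a c.
Proof.
elim: s => [|s IHs].
  rewrite big_ord1 surj0n scale1r /divided_euler big_ord1.
  by rewrite !bin0 mul1n scale1r subn0 !addn0.
rewrite iterS IHs euler_op_sum [RHS]big_ord_recl surjn0 scale0r add0r.
under eq_bigr do rewrite euler_opZ euler_op_divided scalerDr !scalerA.
under [RHS]eq_bigr do rewrite lift0 surjSS mulrDr scalerDl.
rewrite !big_split /=; congr (_ + _).
  rewrite big_ord_recl mulr0 scale0r add0r [RHS]big_ord_recr /= surj_gt //.
  by rewrite mulr0 scale0r addr0; apply: eq_bigr => k _; rewrite mulrC.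
by apply: eq_bigr => k _; rewrite mulrC.
Qed.

(** * The index conditions and binomial products of [lcoef] *)

Lemma big_tupleS_and (V : nmodType) (N r : nat) (P Q : pred (seq nat))
    (p : pred nat) (F : seq nat -> V) :
  (forall i t, size t = r -> P (i :: t) = p i && Q t) ->
  \sum_(t : r.+1.-tuple 'I_N | P (map val t)) F (map val t) =
  \sum_(i < N | p i) \sum_(t : r.-tuple 'I_N | Q (map val t))
    F (val i :: map val t).
Proof.
move=> PQ.
rewrite (@big_tupleS _ _ _ (fun t => P (map val t)) (fun t => F (map val t))).
rewrite [RHS]big_mkcond; apply: eq_bigr => i _ /=.
under eq_bigl do rewrite PQ ?size_map ?size_tuple //.
by case: (p i); rewrite ?big_pred0_eq.
Qed.

Lemma forall_ordS n (P : pred nat) :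
  [forall m : 'I_n.+1, P m] = P 0%N && [forall m : 'I_n, P m.+1].
Proof.
apply/forallP/andP => [PP|[P0 /forallP PS] m].
  split; first exact: PP ord0.
  by apply/forallP => m; rewrite -lift0.
by case: (unliftP ord0 m) => [j|] ->; rewrite ?lift0.
Qed.

(* The conditions on the tuples k and t in the definition of lcoef. *)
Definition admissible_k (s k : seq nat) : bool :=
  [forall m : 'I_(size s), (1 <= entry k m.+1 <= entry s m.+1)%N].

Definition admissible_t (k t : seq nat) : bool :=
  [forall m : 'I_(size k).-1, (entry t m.+1 <= entry k m.+1)%N].

Lemma admissible_k_cons a s b k :
  admissible_k (a :: s) (b :: k) = (1 <= b <= a)%N && admissible_k s k.
Proof.
by rewrite /admissible_k
  (forall_ordS _ (fun m => 1 <= entry (b :: k) m.+1 <= entry (a :: s) m.+1)%N).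
Qed.

Lemma admissible_t_cons b k u t : (0 < size k)%N ->
  admissible_t (b :: k) (u :: t) = (u <= b)%N && admissible_t k t.
Proof.
rewrite /admissible_t /=; case: (size k) => //= n _.
by rewrite (forall_ordS _ (fun m => entry (u :: t) m.+1 <= entry (b :: k) m.+1)%N).
Qed.

Lemma admissible_k_sumn s k : size k = size s -> admissible_k s k ->
  (size s <= sumn k <= sumn s)%N.
Proof.
elim: s k => [|a s IHs] [|b k] //= [/IHs{}IHs].
rewrite admissible_k_cons => /andP[ba /IHs]; lia.
Qed.

(** Each t_m is bounded by its k_m, while k_r >= 1 faces no t; hence the strict inequality, which
    makes i - 1 - j nonnegative. *)
Lemma admissible_t_sumn s k t : size k = size s -> size t = (size s).-1 ->
  (0 < size s)%N -> admissible_k s k -> admissible_t k t ->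
  (sumn t < sumn k)%N && (sumn t <= \sum_(1 <= m < size s) entry s m)%N.
Proof.
elim: s k t => [|a s IHs] [|b k] t //= [sk] + _.
rewrite admissible_k_cons => st /andP[/andP[b1 ba] kA].
case: s => [|a' s] /= in st sk IHs kA *.
  by case: t st => //= _ _; rewrite addn_gt0 b1.
case: t st => //= u t [st]; rewrite admissible_t_cons ?sk // => /andP[ub tA].
have /andP[lt1 le1] := IHs k t sk st isT kA tA.
rewrite big_nat_recl // (eq_big_nat _ _ (F2 := fun m => entry (a' :: s) m)).
  by rewrite -addnS (leq_add ub lt1) (leq_add (leq_trans ub ba) le1).
by move=> -[].
Qed.

Definition surj_weight (s k : seq nat) : rat :=
  \prod_(1 <= n < (size s).+1) surj (entry s n) (entry k n).

Lemma surj_weight_cons a s b k :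
  surj_weight (a :: s) (b :: k) = surj a b * surj_weight s k.
Proof.
by rewrite /surj_weight big_nat_recl //; congr (_ * _); apply: eq_big_nat => -[].
Qed.

Lemma sum_entry a : (\sum_(1 <= m < (size a).+1) entry a m = sumn a)%N.
Proof.
elim: a => [|x a IHa]; first by rewrite big_geq.
rewrite big_nat_recl //= -[in RHS]IHa; congr (_ + _)%N.
by apply: eq_big_nat => -[].
Qed.

(** Factors are numbered from the end of the word: a new first letter only shifts positions in the
    factors p < r and adds the factor p = r. *)
Lemma lcoef_binom_cons r b k u t : (0 < r)%N -> size k = r -> size t = r.-1 ->
  lcoef_binom r.+1 (b :: k) (u :: t) =
  ('C(sumn k + r - sumn t, u) * 'C(b + sumn t, b - u) * lcoef_binom r k t)%N.
Proof.
move=> r0 sk st; rewrite /lcoef_binom big_nat_recr //= mulnC.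
have entryS x a m : (0 < m)%N -> entry (x :: a) m.+1 = entry a m by case: m.
have shift p q x a : (0 < p)%N ->
    (\sum_(p.+1 <= m < q.+1) entry (x :: a) m = \sum_(p <= m < q) entry a m)%N.
  move=> p0; rewrite big_add1 /=; apply: eq_big_nat => m /andP[pm _].
  by rewrite entryS // (leq_trans p0).
congr (_ * _)%N.
  have Ek : (\sum_(1 <= m < r.+1) entry k m = sumn k)%N by rewrite -sk sum_entry.
  have Et : (\sum_(1 <= m < r) entry t m = sumn t)%N.
    by rewrite -(prednK r0) -st sum_entry.
  by rewrite subSnn add1n !shift // Ek Et.
apply: eq_big_nat => p /andP[p1 pr].
rewrite subSn 1?ltnW // addSn !shift ?addn1 //.
by rewrite !entryS // subn_gt0.
Qed.

(** * Expansion of the polynomials in the coefficients [lcoef] *)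

(** Gives the sums the shape of those in [lcoef]: k >= 1 because S_2(s,0) = 0 for s >= 1, and one
    bound N serves all indices. *)
Lemma iter_euler_op_monomial_widen N s a c : (0 < s < N)%N ->
  iter s euler_op ('X^a * (1 + 'X) ^+ c.+1 : {poly rat}) =
  \sum_(k < N | (1 <= k <= s)%N) surj s k *:
    \sum_(t < N | (t <= k)%N) ('C(a, t) * 'C(c + k, k - t))%:R *:
      ('X^(a + k - t) * (1 + 'X) ^+ (c + t).+1).
Proof.
case/andP=> s0 sN; rewrite iter_euler_op_monomial.
rewrite (big_ord_widen N (fun k => surj s k *: divided_euler k a c)) //.
rewrite big_mkcond [RHS]big_mkcond; apply: eq_bigr => k _; rewrite ltnS.
have [->|k0] := posnP k; first by case: s s0 {sN} => // s; rewrite surjn0 scale0r.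
case: leqP => //= ks; congr (_ *: _).
by rewrite /divided_euler (big_ord_widen N (fun t =>
  ('C(a, t) * 'C(c + k, k - t))%:R *:
    ('X^(a + k - t) * (1 + 'X) ^+ (c + t).+1))).
Qed.

(** Induction from the innermost letter outwards: each letter contributes its k and t when D^s is
    expanded on a monomial. The free bound N gives the shorter word the same index types. *)
Lemma Li_poly_tuples (N : nat) a s :
  all (leq 1) (a :: s) -> all (gtn N) (a :: s) ->
  Li_poly rat a s =
  \sum_(k : (size s).+1.-tuple 'I_N | admissible_k (a :: s) (map val k))
    surj_weight (a :: s) (map val k) *:
    \sum_(t : (size s).-tuple 'I_N | admissible_t (map val k) (map val t))
      (lcoef_binom (size s).+1 (map val k) (map val t))%:R *:
      ('X^(sumn (map val k) + size s - sumn (map val t))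
        * (1 + 'X) ^+ (sumn (map val t)).+1).
Proof.
elim: s a => [|a' s IHs] a /= /andP[a1 aa] /andP[aN aaN].
  rewrite (@big_tupleS_and _ _ _ (fun k => admissible_k [:: a] k) xpredT
    (fun b => 1 <= b <= a)%N
    (fun k => surj_weight [:: a] k *:
      \sum_(t : 0.-tuple 'I_N | admissible_t k (map val t))
      (lcoef_binom 1 k (map val t))%:R *:
      ('X^(sumn k + 0 - sumn (map val t))
        * (1 + 'X) ^+ (sumn (map val t)).+1))); last first.
    move=> i [] // _; rewrite admissible_k_cons /admissible_k; congr (_ && _).
    by apply/forallP => -[].
  (* As a >= 1, D^a X = D^a (1+X); starting from X^0 (1+X) means that the innermost letter carries
     no t. *)
  have -> : Li_poly rat a [::] = iter a euler_op (1 + 'X).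
    by case: a a1 {aN} => // n _; rewrite iter_euler_op_addl1.
  have := @iter_euler_op_monomial_widen N a 0 0; rewrite mul1r expr1 a1 => -> //.
  apply: eq_bigr => b /andP[b1 ba]; rewrite big_tuple0 /= surj_weight_cons.
  rewrite [surj_weight [::] _]big_geq // mulr1; congr (_ *: _).
  rewrite big_tuple0 /= ifT; last by apply/forallP => -[].
  rewrite /lcoef_binom big_geq // scale1r !addn0 subn0.
  have N0 : (0 < N)%N by apply: leq_ltn_trans aN.
  (* C(0,t) leaves only t = 0. *)
  rewrite (bigD1 (Ordinal N0)) //= big1 => [|t /andP[_ t0]].
    by rewrite !subn0 !add0n !binn scale1r addr0.
  by rewrite bin_small ?mul0n ?scale0r // lt0n.
rewrite /Li_poly /= -/(Li_poly rat a' s) (IHs a') ?aN ?aa //.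
rewrite mulr_sumr.
rewrite (@big_tupleS_and _ _ _ (admissible_k [:: a, a' & s])
    (admissible_k (a' :: s)) (fun b => 1 <= b <= a)%N
    (fun k => surj_weight [:: a, a' & s] k *:
      \sum_(t : (size s).+1.-tuple 'I_N | admissible_t k (map val t))
      (lcoef_binom (size s).+2 k (map val t))%:R *:
      ('X^(sumn k + (size s).+1 - sumn (map val t))
        * (1 + 'X) ^+ (sumn (map val t)).+1))); last first.
  by move=> i t _; rewrite admissible_k_cons.
rewrite exchange_big iter_euler_op_sum; apply: eq_bigr => kt kA.
have sk : size (map val kt) = (size s).+1 by rewrite size_map size_tuple.
move: (map val kt) kA sk => k kA sk {kt}.
under [RHS]eq_bigr do rewrite surj_weight_cons mulrC -scalerA.
rewrite -scalerAr iter_euler_opZ -scaler_sumr; congr (_ *: _).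
rewrite mulr_sumr iter_euler_op_sum.
pose G (i u : nat) (v : seq nat) : {poly rat} :=
  (lcoef_binom (size s).+2 (i :: k) (u :: v))%:R *:
    ('X^(sumn (i :: k) + (size s).+1 - sumn (u :: v)) *
      (1 + 'X) ^+ (sumn (u :: v)).+1).
transitivity (\sum_(v : (size s).-tuple 'I_N | admissible_t k (map val v))
    \sum_(i < N | (1 <= i <= a)%N)
      surj a i *: \sum_(u < N | (u <= i)%N) G i u (map val v)).
  apply: eq_bigr => vt vA.
  have sv : size (map val vt) = size s by rewrite size_map size_tuple.
  move: (map val vt) vA sv => v vA sv {vt}.
  have /andP[vk _] : (sumn v < sumn k)%N && _ :=
    admissible_t_sumn (s := a' :: s) sk sv isT kA vA.
  rewrite -scalerAr iter_euler_opZ mulrA -exprS -subSn; last first.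
    by rewrite (leq_trans (ltnW vk)) ?leq_addr.
  (* Here a is [sumn k + (size s).+1 - sumn v] and c is [sumn v], so the new binomials are those of
     [lcoef_binom_cons]. *)
  rewrite (@iter_euler_op_monomial_widen N) ?a1 // scaler_sumr.
  apply: eq_bigr => i _; rewrite scalerA mulrC -scalerA; congr (_ *: _).
  rewrite scaler_sumr; apply: eq_bigr => u _; rewrite scalerA -natrM /G.
  rewrite lcoef_binom_cons // mulnC addnS [(i + sumn v)%N]addnC.
  congr (_ *: ('X^_ * _ ^+ _.+1)); rewrite /=; lia.
rewrite exchange_big; apply: eq_bigr => i _; rewrite -scaler_sumr.
congr (_ *: _); rewrite exchange_big; symmetry.
rewrite (@big_tupleS_and _ _ _ (admissible_t (val i :: k)) (admissible_t k)
  (fun u => u <= i)%N (fun v => (lcoef_binom (size s).+2 (val i :: k) v)%:R *: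
    ('X^(sumn (val i :: k) + (size s).+1 - sumn v) *
      (1 + 'X) ^+ (sumn v).+1))) // => u v sv.
by rewrite admissible_t_cons // sk.
Qed.

Lemma sum_fibers (V : nmodType) (I : finType) (A : pred I) (h : I -> nat)
    (m n : nat) (F : I -> nat -> V) :
  (forall k, A k -> (m <= h k < n)%N) ->
  \sum_(k | A k) F k (h k) =
  \sum_(m <= i < n) \sum_(k | A k && (h k == i)) F k i.
Proof.
move=> hA; rewrite (exchange_big_dep A) /=; last by move=> i k _ /andP[].
apply: eq_bigr => k Ak; rewrite Ak /=.
under eq_bigl do rewrite eq_sym.
by rewrite big_nat1_eq hA.
Qed.

Lemma lcoefE s i j : lcoef s i j =
  \sum_(k : (size s).-tuple 'I_(sumn s).+1 |
      admissible_k s (map val k) && (sumn (map val k) == i))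
    surj_weight s (map val k) *
    \sum_(t : (size s).-1.-tuple 'I_(sumn s).+1 |
        admissible_t (map val k) (map val t) && (sumn (map val t) == j))
      (lcoef_binom (size s) (map val k) (map val t))%:R.
Proof.
have tnthE n N (x : n.-tuple 'I_N) (m : 'I_n) :
    tnth x m = entry (map val x) m.+1 :> nat.
  by rewrite /entry -tnth_map (tnth_nth 0%N).
apply: eq_big => [k|k _].
  by congr (_ && _); apply: eq_forallb => m; rewrite tnthE.
congr (_ * _); apply: eq_bigl => t; congr (_ && _).
rewrite /admissible_t size_map size_tuple.
by apply: eq_forallb => m; rewrite tnthE.
Qed.

Lemma lcoef_eq0 s i j : (0 < size s)%N -> (i <= j)%N -> lcoef s i j = 0.
Proof.
move=> s0 ij; rewrite lcoefE big1 // => k /andP[kA /eqP ki].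
rewrite big1 ?mulr0 // => t /andP[tA /eqP tj].
have := admissible_t_sumn _ _ s0 kA tA.
by rewrite !size_map !size_tuple ki tj ltnNge ij => /(_ erefl erefl).
Qed.

Lemma Li_poly_lcoef a s : all (leq 1) (a :: s) ->
  Li_poly rat a s =
  \sum_((size s).+1 <= i < (sumn (a :: s)).+1)
    \sum_(0 <= j < (\sum_(1 <= m < (size s).+1) entry (a :: s) m).+1)
      lcoef (a :: s) i j *: ('X^(i + size s - j) * (1 + 'X) ^+ j.+1).
Proof.
move=> ss; have sN : all (gtn (sumn (a :: s)).+1) (a :: s).
  elim: (a :: s) => // x l IHl /=; rewrite ltnS leq_addr /=.
  apply: sub_all IHl => y /= yl; rewrite (leq_trans yl) // ltnS leq_addl //.
rewrite (Li_poly_tuples ss sN).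
rewrite (@sum_fibers _ _ _
  (fun k : (size s).+1.-tuple 'I_(sumn (a :: s)).+1 => sumn (map val k))
  (size s).+1
  (sumn (a :: s)).+1 (fun k i => surj_weight (a :: s) (map val k) *:
    \sum_(t : (size s).-tuple 'I_(sumn (a :: s)).+1
        | admissible_t (map val k) (map val t))
      (lcoef_binom (size s).+1 (map val k) (map val t))%:R *:
      ('X^(i + size s - sumn (map val t))
        * (1 + 'X) ^+ (sumn (map val t)).+1))); last first.
  move=> k kA; rewrite ltnS; apply: (admissible_k_sumn _ kA).
  by rewrite size_map size_tuple.
apply: eq_bigr => i _; under [RHS]eq_bigr do rewrite lcoefE scaler_suml.
rewrite exchange_big; apply: eq_bigr => k /andP[kA _].
under [RHS]eq_bigr do rewrite -scalerA scaler_suml.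
rewrite -scaler_sumr; congr (_ *: _).
rewrite (@sum_fibers _ _ _
  (fun t : (size s).-tuple 'I_(sumn (a :: s)).+1 => sumn (map val t)) 0
  (\sum_(1 <= m < (size s).+1) entry (a :: s) m).+1
  (fun t j => (lcoef_binom (size s).+1 (map val k) (map val t))%:R *:
      ('X^(i + size s - j) * (1 + 'X) ^+ j.+1))) // => t tA.
have := @admissible_t_sumn (a :: s) (map val k) (map val t).
by rewrite !size_map !size_tuple => /(_ erefl erefl isT kA tA)/andP[].
Qed.

(** * Convergence on the unit disc *)

Section Analytic.
Local Open Scope classical_set_scope.
Local Open Scope complex_scope.
Variable R : realType.
Implicit Types z : Cplx R.

Lemma disc_subr_neq0 z : `|z| < 1 -> 1 - z != 0.
Proof.
by move=> z1; rewrite subr_eq0; apply: contraTneq z1 => <-; rewrite normr1 ltxx.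
Qed.

(** The modulus of z is a real number in [0,1), so the real geometric sequence gives the limit. *)
Lemma cvg_exprC z : `|z| < 1 -> (GRing.exp z : (Cplx R)^nat) @ \oo --> 0.
Proof.
have real_part (x : Cplx R) : 0 <= x -> exists r : R, x = r%:C.
  by move=> x0; exists (complex.Re x); rewrite RRe_real // ger0_real.
move=> z1; have [r rz] := real_part `|z| (normr_ge0 z).
have r0 : 0 <= r by rewrite -ler0c -rz normr_ge0.
have r1 : `|r| < 1 by rewrite ger0_norm // -ltcR -rz.
apply/cvgr0Pnorm_lt => e e0; have [d ed] := real_part e (ltW e0).
have d0 : 0 < d by rewrite -ltcR -ed.
have /cvgr0Pnorm_lt/(_ d d0) := cvg_expr r1.
apply: filterS => n; rewrite normrX ger0_norm // -ltcR rmorphXn /= -rz -ed.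
by rewrite normrX.
Qed.

Lemma cvg_lambda_coef_expr z k : `|z| < 1 ->
  (lambda_coef k n)%:R * z ^+ n @[n --> \oo] --> 0.
Proof.
move=> z1; pose r := (`|z| + 1) / 2; have [zr r1] : `|z| < r /\ r < 1.
  by rewrite /r; have := midf_lt z1; rewrite !midf_lt.
have r0 : 0 < r by apply: le_lt_trans zr.
(* Then 1 + h = 1/r, and [lambda_coef_le] bounds the modulus of the nth term by (|z|/r)^n / h^k. *)
pose h := r^-1 - 1; have h0 : 0 < h by rewrite subr_gt0 invf_gt1.
have hk : 0 < h ^+ k by rewrite exprn_gt0.
have /cvg_exprC/cvgr0Pnorm_lt qlim : `|z / r| < 1.
  by rewrite normrM normfV (gtr0_norm r0) ltr_pdivrMr // mul1r.
apply/cvgr0Pnorm_lt => e e0.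
have := qlim (e * h ^+ k) (mulr_gt0 e0 hk); apply: filterS => n.
rewrite -ltr_pdivrMr //; apply: le_lt_trans.
rewrite ler_pdivlMr // !normrM !normrX normrM normfV normr_nat (gtr0_norm r0).
rewrite mulrAC [leRHS]exprMn mulrC ler_wpM2l ?exprn_ge0 // -[r^-1](subrKC 1).
exact: lambda_coef_le (ltW h0).
Qed.

Lemma cvg_lambda_series z k : `|z| < 1 ->
  \sum_(n < N) (lambda_coef k n)%:R * z ^+ n @[N --> \oo] --> lambda z ^+ k.
Proof.
move=> z1; have z1' := disc_subr_neq0 z1.
elim: k => [|k IHk].
  have E N : (0 < N)%N -> \sum_(n < N) (lambda_coef 0 n)%:R * z ^+ n = 1.
    case: N => // N _; rewrite big_ord_recl big1 ?addr0 ?mulr1 // => i _.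
    by rewrite lift0 mul0r.
  by apply: cvg_near_cst; near=> N; apply: E; near: N; exists 1%N.
(* Partial-sum form of (1-z) lambda^(k+1) = z lambda^k; the boundary term tends to 0. *)
have E N : \sum_(n < N) (lambda_coef k.+1 n)%:R * z ^+ n =
    (z * \sum_(n < N) (lambda_coef k n)%:R * z ^+ n
      - (lambda_coef k.+1 N)%:R * z ^+ N) / (1 - z).
  apply: (canRL (mulfK z1')); elim: N => [|N IHN].
    by rewrite !big_ord0 mulr0 !mul0r subr0.
  by rewrite !big_ord_recr /= mulrDl IHN natrD exprS; ring.
under eq_fun do rewrite E.
have -> : lambda z ^+ k.+1 = (z * lambda z ^+ k - 0) / (1 - z).
  by rewrite subr0 exprS mulrAC.
apply: cvgMr_tmp; apply: cvgB; last exact: cvg_lambda_coef_expr.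
exact: cvgMl_tmp.
Unshelve. all: by end_near.
Qed.

Lemma cvg_zcoef z (p : {poly Cplx R}) : `|z| < 1 ->
  \sum_(n < N) zcoef n p * z ^+ n @[N --> \oo] --> p.[lambda z].
Proof.
move=> z1.
have E N : \sum_(n < N) zcoef n p * z ^+ n =
   \sum_(k < size p) p`_k * \sum_(n < N) (lambda_coef k n)%:R * z ^+ n.
  under [RHS]eq_bigr do rewrite mulr_sumr.
  rewrite exchange_big; apply: eq_bigr => n _; under eq_bigr do rewrite mulrA.
  by rewrite -mulr_suml zcoef_size.
under eq_fun do rewrite E.
rewrite horner_coef; apply: cvg_big => [|i _]; first exact: add_continuous.
by apply: cvgMl_tmp; exact: cvg_lambda_series.
Qed.
End Analytic.

(** * Transfer of the polynomial identities to polylogarithms *)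

Section Polylogarithms.
Variable R : realType.
Implicit Types (z : Cplx R) (s : nat) (w : seq nat).

Lemma zcoef0_Li_poly (K : comNzRingType) s w : zcoef 0 (Li_poly K s w) = 0.
Proof.
rewrite zcoef_iter_euler; case: w => [|t w]; first by rewrite zcoefX mulr0.
by rewrite /= zcoef_mulX big_ord0 mulr0.
Qed.

Lemma Li_partial_cons s w z N :
  Li_partial (s :: w) z N = \sum_(i < N) zcoef i (Li_poly (Cplx R) s w) * z ^+ i.
Proof.
rewrite /Li_partial -/(weight _ _ _).
rewrite (@big_tupleS _ _ _
  (fun n => sorted gtn (map val n) && all (leq 1) (map val n))
  (fun n => weight (Cplx R) (s :: w) (map val n) * z ^+ entry (map val n) 1)).
apply: eq_bigr => i _ /=; have [i0|i0] := posnP i.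
  by rewrite i0 big_pred0 ?zcoef0_Li_poly ?mul0r // => t; rewrite andbF.
rewrite -mulr_suml; congr (_ * _); rewrite zcoef_iter_euler.
under eq_bigr do rewrite weight_cons.
by rewrite -mulr_sumr (@sum_weight_decreasing _ w N) // ltnW.
Qed.

Lemma cvg_Li_partial s w z : `|z| < 1 ->
  (Li_partial (s :: w) z @ \oo --> (Li_poly (Cplx R) s w).[lambda z])%classic.
Proof.
move=> z1; rewrite (funext (Li_partial_cons s w z)); exact: cvg_zcoef.
Qed.

Lemma LiE s w z : `|z| < 1 -> Li (s :: w) z = (Li_poly (Cplx R) s w).[lambda z].
Proof. by move=> z1; apply: cvg_lim => //; exact: cvg_Li_partial. Qed.

Lemma Li_shuffle s1 s2 w z : `|z| < 1 ->
  Li [:: s1, s2 & w] z =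
  \sum_(0 <= t < s1.+1)
    ('C(s1, t))%:R * Li [:: t] z * Li ((s1 + s2 - t)%N :: w) z.
Proof.
move=> z1; rewrite LiE // Li_poly_shuffle horner_sum big_mkord.
apply: eq_bigr => t _; rewrite !hornerM !LiE //.
by rewrite -polyC_natr hornerC.
Qed.

Lemma lambdaD1 z : `|z| < 1 -> 1 + lambda z = (1 - z)^-1.
Proof.
move=> /disc_subr_neq0 z1; rewrite /lambda -[X in X + _](divff z1) -mulrDl.
by rewrite subrK mul1r.
Qed.

Lemma Li_eulerian1 s z : `|z| < 1 ->
  Li [:: s] z = lambda z * (map_poly intr (eulerian s)).[z] * (1 - z) ^- s.
Proof.
move=> z1; rewrite LiE // Li_poly1 horner_sum.
rewrite (@horner_coef_wide _ s.+1); last first.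
  apply: leq_trans (size_poly _ _) _.
  case: s => [|s] /=; first by rewrite size_poly1.
  exact: leq_trans (size_poly _ _) (leqnSn _).
rewrite mulr_sumr mulr_suml; apply: eq_bigr => k _.
rewrite coef_map coef_eulerian !hornerE ?hornerXn ?horner_exp ?hornerE lambdaD1 //.
rewrite -exprVn -[X in _ = _ * _ ^+ X](subnKC (leq_ord k)) exprD /lambda.
by rewrite !exprMn !exprS /=; set u := (1 - z)^-1; ring.
Qed.

(** [ext_eulerian] obeys the recursion of [Li_shuffle], all of whose summands carry the same powers
    of lambda and 1 - z. *)
Lemma Li_eulerian w z : `|z| < 1 ->
  Li w z = lambda z ^+ size w
           * (map_poly intr (ext_eulerian w)).[z] * (1 - z) ^- sumn w.
Proof.
move=> z1; case: w => [|s w].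
  by rewrite /= rmorph1 hornerC expr0 invr1 !mulr1.
elim: w s => [|s2 w IHw] s; first by rewrite Li_eulerian1 //= addn0.
rewrite Li_shuffle // rmorph_sum horner_sum big_mkord mulr_sumr mulr_suml.
apply: eq_bigr => t _; rewrite Li_eulerian1 // IHw !rmorphM !hornerM rmorph_nat.
rewrite -polyC_natr hornerC /= -/(ext_eulerian_cons _ _).
have -> : (s + (s2 + sumn w) = t + (s + s2 - t + sumn w))%N.
  have ts := leq_ord t; lia.
rewrite -!exprVn !exprD !exprS; set u := (1 - z)^-1.
ring.
Qed.

Lemma Li_inv_poly s w : exists P : {poly int},
  size P = (sumn (s :: w) + size (s :: w)).+1 /\
  forall z, `|z| < 1 -> Li (s :: w) z = (map_poly intr P).[(1 - z)^-1].
Proof.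
(* lambda(z) = (1-z)^-1 - 1, and a substitution of degree one preserves the degree. *)
exists (Li_poly int s w \Po ('X - 1%:P)); split.
  by rewrite size_comp_poly2 ?size_XsubC // size_Li_poly.
move=> z z1; rewrite map_comp_poly map_Li_poly horner_comp LiE // -lambdaD1 //.
by rewrite rmorphB /= map_polyX map_polyC /= !hornerE mulr1z addrAC subrr add0r.
Qed.

(** In [stirling1_inversion] the term j = 0 has coefficient S_1(k,1) = (k-1)! and yields (1-z)^-1;
    the others are polylogarithms by [iter_euler_op_addl1]. *)
Lemma Li_stirling1 k z : (1 <= k)%N -> `|z| < 1 ->
  (1 - z) ^- k =
  (1 - z)^-1
  + \sum_(2 <= j < k.+1)
      (stirling1 k j)%:~R * Li [:: j.-1] z / ((k.-1)`!)%:R.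
Proof.
case: k => // k _ z1.
have k0 : k`!%:R != 0 :> Cplx R by rewrite pnatr_eq0 -lt0n fact_gt0.
have := congr1 (fun p => p.[lambda z]) (stirling1_inversion (Cplx R) k).
have u : (1 + 'X).[lambda z] = (1 - z)^-1.
  by rewrite hornerD hornerC hornerX lambdaD1.
rewrite hornerZ horner_exp u exprVn horner_sum => E.
apply: (mulfI k0); rewrite E mulrDr big_ord_recl stirling1_1 hornerZ u.
rewrite rmorph_nat; congr (_ + _).
rewrite big_add1 big_add1 big_mkord mulr_sumr; apply: eq_bigr => j _.
rewrite lift0 LiE // iter_euler_op_addl1 hornerZ -[k.+1.-1]/k.
by rewrite [RHS]mulrCA divff // mulr1.
Qed.

Lemma Li_lcoef (a : nat) (s : seq nat) z : all (leq 1) (a :: s) -> `|z| < 1 ->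
  Li (a :: s) z =
  lambda z ^+ (size s).+1
  * \sum_((size s).+1 <= i < (sumn (a :: s)).+1)
      \sum_(0 <= j < (\sum_(1 <= m < (size s).+1) entry (a :: s) m).+1)
        ratr (lcoef (a :: s) i j) * (z ^ (i%:Z - 1 - j%:Z) / (1 - z) ^+ i).
Proof.
move=> s1 z1; rewrite LiE //; have [->|z0] := eqVneq z 0.
  rewrite /lambda mul0r expr0n mul0r horner_coef0.
  by have := zcoef0_Li_poly (Cplx R) a s; rewrite /zcoef big_ord1 mulr1.
rewrite -(map_Li_poly (@ratr (Cplx R))) Li_poly_lcoef // rmorph_sum horner_sum.
rewrite mulr_sumr; apply: eq_big_nat => i /andP[i1 _].
rewrite rmorph_sum horner_sum mulr_sumr; apply: eq_big_nat => j _.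
(* Terms with j >= i have zero coefficient, so the integer exponent i - 1 - j is a natural number in
   the others. *)
have [ji|ij] := ltnP j i; last first.
  by rewrite lcoef_eq0 // scale0r !rmorph0 horner0 mul0r mulr0.
rewrite /= map_polyZ rmorphM /= map_polyXn rmorphXn rmorphD rmorph1 /= map_polyX.
move: (ratr _) => c; rewrite !hornerE ?hornerXn ?horner_exp ?hornerE lambdaD1 //.
have -> : i%:Z - 1 - j%:Z = (i - j.+1)%N.
  by rewrite -subzn // -addn1 PoszD opprD addrA addrAC.
(* With m = i - j - 1 and r letters, lambda^(r+m) (1-z)^-(j+1) = lambda^r z^m (1-z)^-i. *)
rewrite -exprnP -!exprVn; have := subnK ji; move: (i - j.+1)%N => m <-.
have -> : (m + j.+1 + size s - j = (size s).+1 + m)%N by lia.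
by rewrite !exprD /lambda !exprMn /=; set u := (1 - z)^-1; ring.
Qed.
End Polylogarithms.

Theorem theorem2 (R : realType) :
  (* the series defining Li converge on the unit disc *)
  (forall (w : seq nat) (z : Cplx R), `|z| < 1 -> cvgn (Li_partial w z))
  /\
  (* (1) *)
  (forall (s1 s2 : nat) (w : seq nat) (z : Cplx R), `|z| < 1 ->
     Li [:: s1, s2 & w] z =
     \sum_(0 <= t < s1.+1)
       ('C(s1, t))%:R * Li [:: t] z * Li ((s1 + s2 - t)%N :: w) z)
  /\
  (* (2) *)
  (forall (w : seq nat),
     (forall z : Cplx R, `|z| < 1 ->
        Li w z = lambda z ^+ size w
                 * (map_poly intr (ext_eulerian w)).[z] * (1 - z) ^- sumn w)
     /\
     exists P : {poly int},
       size P = (sumn w + size w).+1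
       /\ forall z : Cplx R, `|z| < 1 ->
            Li w z = (map_poly intr P).[(1 - z)^-1])
  /\
  (forall (k : nat) (z : Cplx R), (1 <= k)%N -> `|z| < 1 ->
     (1 - z) ^- k =
     (1 - z)^-1
     + \sum_(2 <= j < k.+1)
         (stirling1 k j)%:~R * Li [:: j.-1] z / ((k.-1)`!)%:R)
  /\
  (* (3) *)
  (forall (s : seq nat) (z : Cplx R),
     (1 <= size s)%N -> all (leq 1) s -> `|z| < 1 ->
     Li s z =
     lambda z ^+ size s
     * \sum_(size s <= i < (sumn s).+1)
         \sum_(0 <= j < (\sum_(1 <= m < size s) entry s m).+1)
           ratr (lcoef s i j) * (z ^ (i%:Z - 1 - j%:Z) / (1 - z) ^+ i)).
Proof.
split=> [[|s w] z z1|].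
(* For the empty word only the empty tuple contributes; its [entry] is the default 0, so the power
   of z is 1. *)
- apply/cvg_ex; exists 1; apply: cvg_near_cst; near=> N.
  by rewrite /Li_partial big_tuple0 /= big_geq // mulr1.
- by apply/cvg_ex; exists (Li_poly (Cplx R) s w).[lambda z]; exact: cvg_Li_partial.
split=> [s1 s2 w z|]; first exact: Li_shuffle.
split=> [w|]; first split=> [z|]; first exact: Li_eulerian.
  case: w => [|s w]; last exact: Li_inv_poly.
  by exists 1; split=> [|z _]; rewrite ?size_poly1 // rmorph1 hornerC.
split=> [k z|[//|a s] z _]; [exact: Li_stirling1 | exact: Li_lcoef].
Unshelve. all: by end_near.
Qed.
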